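(* Let $\Delta$ be a thick building, let $\mathcal{A}$ be the complete apartment system of $\Delta$, and let $\Sigma\in\mathcal{A}$. Let $\kappa$ be an infinite subset of $\Sigma$ (an infinite set of simplices of $\Sigma$). Then the family $\mathcal{A}^*=\{\Sigma^*\in\mathcal{A} : \kappa\not\subseteq\Sigma^*\}$ is a system of apartments for $\Delta$. In particular, $\mathcal{A}'=\mathcal{A}^*\cup\{\Sigma\}$ is also a system of apartments for $\Delta$, and $\kappa$ is contained in a unique member of $\mathcal{A}'$. Hence, if $\kappa$ is any infinite proper convex subcomplex of $\Sigma$, it is not the intersection of all apartments of $\mathcal{A}'$ in which it is contained.
   Context: Buildings are finite-dimensional simplicial complexes (chamber complexes admitting a system of apartments satisfying Tits' axioms), of arbitrary type $(W,S)$. Chambers are the maximal simplices, panels the simplices of codimension 1; $\Delta$ is thick if each panel is contained in at least three chambers. The complete apartment system is the maximal one; it consists of all simplicial subcomplexes isomorphic to the standard Coxeter complex $\Sigma(W,S)$. A subset of it is a system of apartments for $\Delta$ if and only if any two chambers of $\Delta$ are contained in some member of the subset. A chamber subcomplex is convex if it contains every minimal gallery between any two of its chambers; an arbitrary subcomplex is convex if it is an intersection of convex chamber subcomplexes. *)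

(* Defs.v *)
From HB Require Import structures.
From mathcomp Require Import all_boot all_classical.

Set Implicit Arguments.
Unset Strict Implicit.
Unset Printing Implicit Defensive.

Local Open Scope classical_set_scope.
Local Open Scope card_scope.
Local Open Scope group_scope.

Section Coxeter.
Variables (W : groupType) (S : set W).

Definition subgroup (H : set W) : Prop :=
  H 1 /\ forall x y, H x -> H y -> H (x * y^-1).

Definition generated (J : set W) : set W := smallest subgroup J.

(* The last clause is the universal property of the presentation
   W = < S | (s t)^m(s,t) = 1 >, where m(s,t) is the order of s t and there is
   no relation when that order is infinite.  Listing all n with (s t)^n = 1
   amounts to listing the order; s = t, n = 1 gives the relation s^2 = 1. *)
Definition coxeter_system : Prop :=
  [/\ forall s, S s -> s <> 1 /\ s * s = 1,
      generated S = setT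
    & forall (G : groupType) (f : W -> G),
        (forall s t n, S s -> S t -> (s * t) ^+ n = 1 -> (f s * f t) ^+ n = 1) ->
        exists g : {multiplicative W -> G}, forall s, S s -> g s = f s].

Definition standard_coset : set (set W) :=
  [set U | exists w J, J `<=` S /\ U = [set w * u | u in generated J]].

End Coxeter.

Section Complexes.
Variable V : Type.
Implicit Types (X Y : set (set V)) (A B C D : set V).

(* A complex is the set of its simplices, including the empty one; its vertices
   need not exhaust V, so that a complex and its subcomplexes share one V. *)
Definition simplicial_complex X : Prop :=
  [/\ X set0,
      forall A, X A -> finite_set A
    & forall A B, X A -> B `<=` A -> X B].

Definition vertices X : set V := [set v | X [set v]].

Definition subcomplex Y X : Prop := simplicial_complex X /\ X `<=` Y.

Definition simplicial_isomorphism X Y (f : V -> V) : Prop :=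
  set_bij (vertices X) (vertices Y) f /\
  forall A, A `<=` vertices X -> (X A <-> Y (f @` A)).

Definition chamber X : set (set V) :=
  [set C | X C /\ forall D, X D -> C `<=` D -> D = C].

Definition panel X : set (set V) :=
  [set A | exists C v, [/\ chamber X C, C v & A = C `\ v]].

Definition adjacent X C D : Prop :=
  [/\ chamber X C, chamber X D, C <> D
    & exists A, [/\ panel X A, A `<=` C & A `<=` D]].

(* The gallery C :: s, from C to last C s, of length size s. *)
Definition gallery X C (s : seq (set V)) : Prop :=
  chamber X C /\ path (fun D E => `[< adjacent X D E >]) C s.

Definition minimal_gallery X C (s : seq (set V)) : Prop :=
  gallery X C s /\
  forall s', gallery X C s' -> last C s' = last C s -> (size s <= size s')%N.

(* Equality of dimensions is equality of the cardinals of the chambers. *)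
Definition chamber_complex X : Prop :=
  [/\ simplicial_complex X,
      forall A, X A -> exists2 C, chamber X C & A `<=` C,
      forall C D, chamber X C -> chamber X D -> C #= D
    & forall C D, chamber X C -> chamber X D ->
        exists2 s, gallery X C s & last C s = D].

Definition thick X : Prop :=
  forall A, panel X A -> exists C1 C2 C3,
    [/\ chamber X C1, chamber X C2 & chamber X C3] /\
    [/\ A `<=` C1, A `<=` C2 & A `<=` C3] /\
    [/\ C1 <> C2, C1 <> C3 & C2 <> C3].

(* A chamber complex of the same dimension as the ambient chamber complex Y,
   that is, one whose chambers are chambers of Y. *)
Definition chamber_subcomplex Y X : Prop :=
  [/\ subcomplex Y X, chamber_complex X & chamber X `<=` chamber Y].

Definition convex_chamber_subcomplex Y X : Prop :=
  chamber_subcomplex Y X /\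
  forall C s, chamber X C -> chamber X (last C s) -> minimal_gallery Y C s ->
    {in C :: s, forall D, X D}.

Definition convex_subcomplex Y X : Prop :=
  subcomplex Y X /\
  exists F : set (set (set V)),
    [/\ F !=set0, F `<=` convex_chamber_subcomplex Y & X = \bigcap_(Z in F) Z].

End Complexes.

Section Buildings.
Variables (W : groupType) (S : set W) (V : Type).
Implicit Types (Delta X : set (set V)) (A B : set V).

(* The standard Coxeter complex Sigma(W,S) is the poset of standard cosets
   ordered by reverse inclusion; a simplicial complex is isomorphic to it when
   its poset of simplices is. *)
Definition isomorphic_coxeter_complex X : Prop :=
  exists phi : set V -> set W,
    set_bij X (standard_coset S) phi /\
    forall A B, X A -> X B -> (A `<=` B <-> phi B `<=` phi A).

Definition apartment_system Delta (Aps : set (set (set V))) : Prop :=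
  [/\ forall X, Aps X -> subcomplex Delta X /\ isomorphic_coxeter_complex X,
      forall A B, Delta A -> Delta B -> exists2 X, Aps X & X A /\ X B
    & forall X X' A B, Aps X -> Aps X' -> X A -> X B -> X' A -> X' B ->
        exists2 f, simplicial_isomorphism X X' f
          & forall v, (A `|` B) v -> f v = v].

Definition building Delta : Prop :=
  chamber_complex Delta /\ exists Aps, apartment_system Delta Aps.

Definition complete_apartment_system Delta (Aps : set (set (set V))) : Prop :=
  apartment_system Delta Aps /\
  forall Aps', apartment_system Delta Aps' -> Aps' `<=` Aps.

End Buildings.

(* Main.v *)
(* Every pair of simplices lies in an apartment of the complete system that misses
   a simplex of kappa.  Take an apartment X through the pair; if it contains kappa,
   then, only finitely many simplices of X lying in the convex hull of two chambers,
   some wall of X separates a simplex of kappa from the pair.  By thickness, choose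
   a chamber E outside X on a panel in that wall.  The root of X bounded by the wall
   and containing the pair, together with E, is isometric for the Weyl distance to a
   subset of W, and therefore extends to an isometric image of W in Delta.  That
   image is an apartment of the complete system, and it misses the separated
   simplex, because its projections to the panel in X and in the new apartment
   differ.

   Walls are encoded by a cocycle N : W -> (W -> bool), where N w t says that the
   wall of the reflection t separates 1 from w.  It is obtained by applying the
   universal property of the Coxeter presentation to the semidirect product of
   W -> bool by W. *)
From HB Require Import structures.
Require Import Defs.
From mathcomp Require Import all_boot all_classical.

Set Implicit Arguments.
Unset Strict Implicit.
Unset Printing Implicit Defensive.

Local Open Scope classical_set_scope.
Local Open Scope group_scope.

(** * The semidirect product of [W -> bool] by [W] *)

Section Wreath.
Variable W : groupType.

Definition wreath : Type := (W * (W -> bool))%type.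
HB.instance Definition _ := Choice.on wreath.
Implicit Types p q r : wreath.

(** The conjugation in the second component is chosen so that a homomorphism from [W] lifting the
    identity has as second component a map satisfying the cocycle rule of [crossing_cocycle]. *)
Definition wreath_mul p q : wreath :=
  (p.1 * q.1, fun x => p.2 x (+) q.2 (x ^ p.1)).
Definition wreath_one : wreath := (1, fun=> false).
Definition wreath_inv p : wreath := (p.1^-1, fun x => p.2 (x ^ p.1^-1)).

Lemma wreath_mulA : associative wreath_mul.
Proof.
move=> p q r; rewrite /wreath_mul /= mulgA; congr pair; apply/funext => x.
by rewrite conjgM addbA.
Qed.

Lemma wreath_mul1 : left_id wreath_one wreath_mul.
Proof.
move=> [w f]; rewrite /wreath_mul /= mul1g; congr pair; apply/funext => x.
by rewrite conjg1.
Qed.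

Lemma wreath_mulr1 : right_id wreath_one wreath_mul.
Proof.
move=> [w f]; rewrite /wreath_mul /= mulg1; congr pair; apply/funext => x.
by rewrite addbF.
Qed.

Lemma wreath_mulV : left_inverse wreath_one wreath_inv wreath_mul.
Proof.
move=> [w f]; rewrite /wreath_mul /= mulVg; congr pair; apply/funext => x.
by rewrite addbb.
Qed.

Lemma wreath_mulrV : right_inverse wreath_one wreath_inv wreath_mul.
Proof.
move=> [w f]; rewrite /wreath_mul /= mulgV; congr pair; apply/funext => x.
by rewrite -conjgM mulgV conjg1 addbb.
Qed.

HB.instance Definition _ := isGroup.Build wreath wreath_mulA wreath_mul1
  wreath_mulr1 wreath_mulV wreath_mulrV.
End Wreath.

Lemma wreath_pow1 (W : groupType) (p : wreath W) n : (p ^+ n).1 = p.1 ^+ n.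
Proof. by elim: n => // n IH; rewrite !expgS -IH. Qed.

(** * The reflection cocycle of a Coxeter system *)

Section Cocycle.
Variables (W : groupType) (S : set W).
Hypothesis cox : coxeter_system S.

Lemma gen_sqr s : S s -> s * s = 1. Proof. by case: cox => H _ _ /H[]. Qed.
Lemma gen_neq1 s : S s -> s <> 1. Proof. by case: cox => H _ _ /H[]. Qed.
Lemma gen_inv s : S s -> s^-1 = s.
Proof. by move=> Ss; apply/mulg1_eq/gen_sqr. Qed.
Lemma gen_mulK s w : S s -> s * (s * w) = w.
Proof. by move=> Ss; rewrite mulgA gen_sqr // mul1g. Qed.
Lemma gen_mulrK s w : S s -> w * s * s = w.
Proof. by move=> Ss; rewrite -mulgA gen_sqr // mulg1. Qed.

Lemma dihedral_pow s t n : S s -> S t -> s * (s * t) ^- n = (s * t) ^+ n * s.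
Proof.
move=> Ss St; elim: n => [|n IH]; first by rewrite invg1 mulg1 mul1g.
rewrite [in RHS]expgS expgSr invgM invgM (gen_inv Ss) (gen_inv St) -[RHS]mulgA -IH.
by rewrite !mulgA.
Qed.

(** Sending each generator [s] to the pair of [s] and the indicator function of [s] respects the
    Coxeter relations, hence extends to a homomorphism; its second component is the cocycle. *)
Lemma crossing_cocycle : exists N : W -> W -> bool,
  (forall w w' x, N (w * w') x = N w x (+) N w' (x ^ w)) /\
  (forall s x, S s -> N s x = (x == s)).
Proof.
have [_ _ univ] := cox.
pose f (w : W) : wreath W := (w, fun x => x == w).
have [s t n Ss St stn|g gf] := univ (wreath W) f.
  (* The second component counts, modulo 2, the [j < 2m] with [x = (s * t) ^+ j * s]. *)
  have cP m x : ((f s * f t) ^+ m).2 x =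
      \big[addb/false]_(0 <= j < m.*2) (x * s == (s * t) ^+ j).
    elim: m => [|m IH]; first by rewrite big_geq.
    rewrite expgSr doubleS !big_nat_recr //=.
    rewrite -IH -addbA; congr (_ (+) _); rewrite wreath_pow1 /=.
    congr (_ (+) _).
      rewrite -(inj_eq (conjg_inj ((s * t) ^- m))) -conjgM mulgV conjg1.
      rewrite conjgE invgK dihedral_pow // mulgA -expgnDr addnn.
      by rewrite -(inj_eq (mulIg s)) gen_mulrK.
    rewrite -(inj_eq (conjg_inj (s^-1))) conjgK.
    rewrite -(inj_eq (conjg_inj ((s * t) ^- m))) -conjgM mulgV conjg1.
    rewrite !conjgE !invgK -!mulgA (gen_inv Ss) dihedral_pow //.
    rewrite (mulgA s) (mulgA (s * t)) -expgS mulgA -expgnDr addnS addnn.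
    by rewrite -(inj_eq (mulIg s)) gen_mulrK.
  rewrite [LHS]surjective_pairing wreath_pow1 stn; congr pair.
  (* As [(s * t) ^+ n = 1], the terms of index [j] and [j + n] agree, so the two halves of the sum
     cancel. *)
  apply/funext => x; rewrite cP -addnn (big_cat_nat _ (n := n)) ?leq_addr //=.
  rewrite -{2}[n]add0n big_addn addnK.
  under [X in _ (+) X]eq_bigr do rewrite expgnDr stn mulg1.
  by rewrite addbb.
exists (fun w => (g w).2); split=> [w w' x|s x Ss]; last by rewrite gf.
have g1 v : (g v).1 = v.
  have [_ Sgen _] := cox; have : generated S v by rewrite Sgen.
  apply: (smallest_sub (C := @subgroup W) (X := [set v | (g v).1 = v])) => //.
    have gM y z : (g (y * z)).1 = (g y).1 * (g z).1 by rewrite gmulfM.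
    have g1 : (g 1).1 = 1 by apply: (mulgI (g 1).1); rewrite -gM !mulg1.
    split=> [//|y z /= gy gz]; rewrite gM gy; congr (_ * _).
    by apply: (mulIg z); rewrite -{2}gz -gM !mulVg.
  by move=> s Ss; rewrite /= gf.
by rewrite gmulfM /= g1.
Qed.
End Cocycle.

Lemma finite_subsets (T : eqType) (A : set T) :
  finite_set A -> finite_set [set B | B `<=` A].
Proof.
move=> /finite_seqP[s ->].
apply: (sub_finite_set _ (finite_image
  (fun m : (size s).-tuple bool => [set` mask m s]) (@finite_finset _ setT))).
move=> B Bs; exists (map_tuple (fun x => `[< B x >]) (in_tuple s)) => //.
apply/seteqP; split=> x /=; rewrite -filter_mask mem_filter; first by case/andP=> /asboolP.
by move=> Bx; rewrite asboolT // Bs.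
Qed.

(** * Words and generated subgroups *)

Section Words.
Variable W : groupType.
Implicit Types (J K : set W) (w : W).

Inductive word J : nat -> W -> Prop :=
| word_nil : word J 0 1
| word_cons s k w : J s -> word J k w -> word J k.+1 (s * w).

Lemma word_rcons J k w s : word J k w -> J s -> word J k.+1 (w * s).
Proof.
move=> + Js; elim=> [|r {}k {}w Jr _ IH].
  by rewrite mul1g -[s]mulg1; apply/word_cons/word_nil.
by rewrite -mulgA; apply: word_cons.
Qed.

Lemma word_cat J k w k' w' :
  word J k w -> word J k' w' -> word J (k + k') (w * w').
Proof.
move=> + J'; elim=> [|s {}k {}w Js _ IH]; first by rewrite mul1g.
by rewrite -mulgA addSn; apply: word_cons.
Qed.

Lemma word_set0 k w : word set0 k w -> w = 1.
Proof. by case. Qed.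

Lemma generated1 J : generated J 1.
Proof. by move=> H [[]]. Qed.

Lemma generated_sub J : J `<=` generated J.
Proof. by move=> s Js H [_]; apply. Qed.

Lemma generatedF J x y : generated J x -> generated J y -> generated J (x * y^-1).
Proof.
by move=> Jx Jy H HJ; have [[_ HF] _] := HJ; exact: HF (Jx _ HJ) (Jy _ HJ).
Qed.

Lemma generatedV J x : generated J x -> generated J x^-1.
Proof. by move=> Jx; rewrite -[x^-1]mul1g; apply: generatedF => //; apply: generated1. Qed.

Lemma generatedM J x y : generated J x -> generated J y -> generated J (x * y).
Proof. by move=> Jx /generatedV Jy; rewrite -[y]invgK; apply: generatedF. Qed.

Lemma generatedMl J x y : generated J x -> generated J (x * y) <-> generated J y.
Proof.
move=> Jx; split=> Jy; last exact: generatedM.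
by rewrite -[y](mulKg x); apply: generatedM Jy; apply: generatedV.
Qed.

Lemma generated_ind J (P : set W) :
  P 1 -> (forall x y, P x -> P y -> P (x * y^-1)) -> J `<=` P -> generated J `<=` P.
Proof. by move=> P1 PF JP; apply: smallest_sub. Qed.

Lemma generatedS J K : J `<=` K -> generated J `<=` generated K.
Proof.
move=> JK; apply: generated_ind; [exact: generated1|exact: generatedF|].
by move=> s /JK; apply: generated_sub.
Qed.

Lemma word_generated J k w : word J k w -> generated J w.
Proof.
elim=> [|s {}k {}w Js _]; first exact: generated1.
by apply: generatedM; apply: generated_sub.
Qed.

End Words.

(** * Walls, length and parabolic subgroups *)

Section Coxeter.
Variables (W : groupType) (S : set W).
Hypothesis cox : coxeter_system S.

Definition crossing : W -> W -> bool := sval (cid (crossing_cocycle cox)).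
Local Notation N := crossing.

Lemma crossM w w' x : N (w * w') x = N w x (+) N w' (x ^ w).
Proof. by rewrite /crossing; case: cid => N [NM ?] /=; apply: NM. Qed.

Lemma cross_gen s x : S s -> N s x = (x == s).
Proof. by rewrite /crossing; case: cid => N [? Ng] /=; apply: Ng. Qed.

Implicit Types (J : set W) (w : W).

Lemma word_inv J k w : J `<=` S -> word J k w -> word J k w^-1.
Proof.
move=> JS; elim=> [|s {}k {}w Js _ IH]; first by rewrite invg1; exact: word_nil.
by rewrite invgM (gen_inv cox (JS _ Js)); apply: word_rcons.
Qed.

Lemma generated_word J w : J `<=` S -> generated J w -> exists k, word J k w.
Proof.
move=> JS; move: w; apply: generated_ind => [|x y [k kx] [l ly]|s Js].
- by exists 0; exact: word_nil.
- by exists (k + l)%N; apply: word_cat => //; apply: word_inv.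
- by exists 1%N; rewrite -[s]mulg1; apply/word_cons/word_nil.
Qed.

Lemma cross1 x : N 1 x = false.
Proof. by have := crossM 1 1 x; rewrite mulg1 conjg1 addbb. Qed.

(** Strong exchange: [t] is the reflection attached to some letter of the word, and multiplying by
    [t] deletes that letter. The remaining letters stay in [J]. *)
Lemma cross_deletion J k w t : J `<=` S -> word J k w -> N w t ->
  exists2 k', k = k'.+1 & word J k' (t * w).
Proof.
move=> JS + Nt; move=> kw; elim: kw t Nt => [|s {}k {}w Js kw IH] t.
  by rewrite cross1.
have Ss := JS _ Js; rewrite crossM cross_gen //.
have [->|nts] /= := eqVneq t s; first by rewrite (gen_mulK cox) //; exists k.
move=> /IH[k' -> kw']; exists k'.+1 => //.
have -> : t * (s * w) = s * (t ^ s * w) by rewrite conjgE -!mulgA mulVKg.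
exact: word_cons.
Qed.

Lemma ex_word w : exists k, `[< word S k w >].
Proof.
have [_ Sgen _] := cox; have : generated S w by rewrite Sgen.
by move=> /generated_word[] // k kw; exists k; apply/asboolP.
Qed.

Definition len w := ex_minn (ex_word w).

Lemma word_len w : word S (len w) w.
Proof. by rewrite /len; case: ex_minnP => k /asboolP. Qed.

Lemma len_le k w : word S k w -> (len w <= k)%N.
Proof. by rewrite /len; case: ex_minnP => l _ H kw; apply/H/asboolP. Qed.

Lemma len1 : len 1 = 0%N.
Proof. by apply/eqP; rewrite -leqn0; apply/len_le/word_nil. Qed.

Lemma lenV w : len w^-1 = len w.
Proof.
apply/eqP; rewrite eqn_leq len_le; last by apply: word_inv => //; exact: word_len.
by apply: len_le; rewrite -[X in word _ _ X]invgK; apply: word_inv => //; exact: word_len.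
Qed.

Lemma len_genM s w : S s -> (len (s * w) <= (len w).+1)%N.
Proof. by move=> Ss; apply/len_le/word_cons => //; apply: word_len. Qed.

Lemma cross_len w t : N w t -> (len (t * w) < len w)%N.
Proof.
by move=> /(cross_deletion (@subset_refl _ S) (word_len w))[k ->] /len_le.
Qed.

Lemma cross_genM s w : S s -> N (s * w) s = ~~ N w s.
Proof. by move=> Ss; rewrite crossM cross_gen // eqxx conjgE mulKg. Qed.

Lemma cross_genP s w : S s -> N w s = (len (s * w) < len w)%N.
Proof.
move=> Ss; case E: (N w s); first by rewrite cross_len.
have : N (s * w) s by rewrite cross_genM // E.
by move=> /cross_len; rewrite (gen_mulK cox) // => /ltnW; rewrite leqNgt => /negbTE ->.
Qed.

Lemma left_descent w : w <> 1 ->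
  exists s w', [/\ S s, w = s * w', len w = (len w').+1 & N w s].
Proof.
move=> w1; have [k kw] : exists k, k = len w by exists (len w).
have := word_len w; rewrite -kw => kwW; case: kwW w1 kw => // s {}k {}w Ss kw _ E.
exists s, w; have lw : len (s * w) = (len w).+1.
  by apply/eqP; rewrite eqn_leq len_genM //= -E ltnS len_le.
split=> //; first by rewrite E.
by rewrite cross_genP // (gen_mulK cox) // lw.
Qed.

Lemma right_descent w : w <> 1 ->
  exists s w', [/\ S s, w = w' * s & len w = (len w').+1].
Proof.
move=> w1; have [|s [w' [Ss ww' lw _]]] := @left_descent w^-1.
  by move=> E; apply: w1; rewrite -[w]invgK E invg1.
exists s, w'^-1; split=> //; last by rewrite lenV -lw lenV.
by rewrite -[w]invgK ww' invgM (gen_inv cox Ss).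
Qed.

Lemma cross_generated J w t : J `<=` S -> generated J w -> N w t -> generated J t.
Proof.
move=> JS Jw /cross_deletion H; have [k /H[//|k' _ /word_generated Jtw]] := generated_word JS Jw.
by rewrite -[t](mulgK w); apply: generatedF.
Qed.

(** If the first letter [r] of a word for [s] differs from [s], the wall of [r] does not separate 1
    from [s], so the rest of the word crosses it back, and deletion gives a shorter word for [s]. *)
Lemma generated_gen J s : J `<=` S -> S s -> generated J s -> J s.
Proof.
move=> JS Ss /(generated_word JS)[k].
have [n] := ubnP k; elim: n k => // n IH k kn; move E : s => w kw.
case: kw E kn => [/(gen_neq1 cox)//|r {}k {}w Jr kw E]; rewrite -E.
have Nsr : N s r = (r == s) by rewrite cross_gen.
have [<-//|rs] := eqVneq r s; move: Nsr; rewrite (negbTE rs) {1}E cross_genM; last exact: JS.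
move=> /negbFE /(cross_deletion JS kw)[k' kk' kw'] kn.
by apply: (IH k'); rewrite ?E // ltnW // -kk' -ltnS.
Qed.

(** A left descent [s] of [w] outside [J] would lie in the subgroup generated by [S] minus [s],
    which is impossible. So letters of [J] can be stripped from the left of [w] until 1 is
    reached. *)
Lemma generated_cap J w : J `<=` S ->
  (forall s, S s -> ~ J s -> generated (S `\ s) w) -> generated J w.
Proof.
move=> JS; have [n] := ubnP (len w); elim: n w => // n IH w wn H.
have [->|/eqP w1] := eqVneq w 1; first exact: generated1.
have [s [w' [Ss ww' lw Nws]]] := left_descent w1.
have Js : J s.
  apply: contrapT => nJs; have sS : S `\ s `<=` S by move=> ? [].
  by have [_ []] := generated_gen sS Ss (cross_generated sS (H _ Ss nJs) Nws).
rewrite ww'; apply: generatedM; first exact: generated_sub.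
apply: IH; first by move: wn; rewrite lw ltnS.
move=> r Sr nJr; apply/(@generatedMl _ _ s); last by rewrite -ww'; apply: H.
apply: generated_sub; split=> // /= E; by apply: nJr; rewrite -E.
Qed.

Lemma generated0 w : generated set0 w -> w = 1.
Proof. by move=> /generated_word[]// k /word_set0. Qed.

Lemma generated_set1 s w : S s -> generated [set s] w -> w = 1 \/ w = s.
Proof.
move=> Ss /generated_word[]=> [_ -> //|k].
elim=> [|_ {}k {}w -> _ [->|->]]; [by left|right|left]; first by rewrite mulg1.
by rewrite (gen_sqr cox).
Qed.

(** If a wall [t] of [c] fails to separate 1 from some [c * j], then [t ^ c] lies in [generated J],
    and [t * c] is a shorter element of the same coset. The descent stops at an element all of whose
    walls separate 1 from the whole coset. *)
Lemma min_coset_rep J c : J `<=` S -> exists2 d, generated J (c^-1 * d) &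
  forall j t, generated J j -> N d t -> N (d * j) t.
Proof.
move=> JS; have [n] := ubnP (len c); elim: n c => // n IH c cn.
have [/existsNP[j /existsNP[t /not_implyP[Jj /not_implyP[Nct Ncj]]]]|] :=
    pselect (~ forall j t, generated J j -> N c t -> N (c * j) t); last first.
  by move=> /contrapT H; exists c => //; rewrite mulVg; apply: generated1.
have Jtc : generated J (t ^ c).
  apply: (cross_generated JS Jj); move: Ncj; rewrite crossM Nct.
  by case: (N j _).
have [|d Jd dP] := IH (t * c); first exact: leq_trans (cross_len Nct) cn.
exists d => //; move: Jd; rewrite invgM -mulgA => /(generatedM Jtc).
by rewrite conjgE -!mulgA mulVKg mulVKg.
Qed.

(** A left descent of [c] is also one of [w], and removing it from both preserves the inclusion of
    wall sets. *)
Lemma cross_sub_len c w : (forall t, N c t -> N w t) -> (len c <= len w)%N.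
Proof.
have [n] := ubnP (len c); elim: n c w => // n IH c w cn cw.
have [->|/eqP c1] := eqVneq c 1; first by rewrite len1.
have [s [c' [Ss cc' lc Ncs]]] := left_descent c1.
have := cw _ Ncs; rewrite cross_genP // lc; apply: leq_trans; rewrite ltnS.
apply: IH => [|t]; first by move: cn; rewrite lc ltnS.
have -> : c' = s * c by rewrite cc' (gen_mulK cox).
rewrite !crossM !(cross_gen _ Ss); have [->|_] := eqVneq t s; last exact: cw.
by rewrite conjgE mulKg Ncs.
Qed.

(** A gallery from 1 to [w] crosses the wall of [t]: [a] is the chamber just before the first
    crossing and [s] the type of the panel crossed. *)
Lemma cross_conj_gen w t : N w t ->
  exists a s, [/\ S s, s = t ^ a & ~~ N a t].
Proof.
have := word_len w; move: (len w) => k kw.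
elim: kw t => [|s {}k {}w Ss _ IH] t; first by rewrite cross1.
rewrite crossM cross_gen //; have [-> _|nts] := eqVneq t s.
  by exists 1, s; rewrite conjg1 cross1.
move=> /IH[a [r [Sr rE Nat]]]; exists (s * a), r.
by rewrite conjgM crossM (cross_gen _ Ss) (negbTE nts).
Qed.

Lemma finite_word k : finite_set S -> finite_set [set w | word S k w].
Proof.
move=> Sfin; elim: k => [|k IH].
  apply: (@sub_finite_set _ _ [set 1]); last exact: finite_set1.
  by move=> w /= E; inversion E.
apply: sub_finite_set (finite_image2 (fun s w => s * w) Sfin IH).
by move=> w /= E; inversion E; subst; exists s => //; exists w0.
Qed.

Lemma finite_len n : finite_set S -> finite_set [set w | (len w <= n)%N].
Proof.
move=> Sfin; apply: (@sub_finite_set _ _ (\bigcup_(k in `I_n.+1) [set w | word S k w])).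
  by move=> w wn; exists (len w) => //=; apply: word_len.
by apply: bigcup_finite => [|k _]; [exact: finite_II|exact: finite_word].
Qed.
End Coxeter.

(** * Extension of partial isometries for an abstract Weyl distance *)

Section WeylDistance.
Variables (W : groupType) (S : set W).
Hypothesis cox : coxeter_system S.
Variables (T : Type) (dist : T -> T -> W -> Prop).
Hypothesis dist_inj : forall C D w w', dist C D w -> dist C D w' -> w = w'.
Hypothesis dist_sym : forall C D w, dist C D w -> dist D C w^-1.
Hypothesis dist1 : forall C D, dist C D 1 -> C = D.
Hypothesis dist_mid : forall C D w u, dist C D w ->
  exists2 E, dist C E u & dist E D (u^-1 * w).
Hypothesis dist_step : forall C C' D s w, S s -> dist C C' s -> dist C D w ->
  dist C' D w \/ dist C' D (s * w).
Implicit Types (C D E : T) (w s : W) (P M : set (W * T)).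

Local Notation len := (len cox).
Local Notation N := (crossing cox).

Lemma dist_gen_sym C D s : S s -> dist C D s -> dist D C s.
Proof. by move=> Ss /dist_sym; rewrite (gen_inv cox). Qed.

Lemma dist_stepr C D D' s w : S s -> dist D D' s -> dist C D w ->
  dist C D' w \/ dist C D' (w * s).
Proof.
move=> Ss DD' /dist_sym/(dist_step Ss DD')[] /dist_sym; rewrite ?invgM invgK; first by left.
by rewrite (gen_inv cox) //; right.
Qed.

Lemma dist_refll C D w : dist C D w -> dist C C 1.
Proof.
by move=> CD; have [E CE _] := dist_mid 1 CD; rewrite {2}(dist1 CE).
Qed.

(** Let [E] be the chamber one step before [D], with [w = w' * r]. Either [C] and [C'] are
    equidistant from [E] as well and induction applies, or [w = s * w']; in both cases length
    forbids [w' * r = s * w'] when [N w' s] holds. *)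
Lemma cross_equidistant C C' D s w : S s -> dist C C' s ->
  dist C D w -> dist C' D w -> N w s.
Proof.
move=> Ss CC'; have [n] := ubnP (len w); elim: n D w => // n IH D w wn CD C'D.
have [w1|/eqP w1] := eqVneq w 1.
  rewrite w1 in CD C'D; case: (gen_neq1 cox Ss); apply: dist_inj CC' _.
  by rewrite (dist1 C'D).
have [r [w' [Sr wE lw]]] := right_descent cox w1.
have [E CE] := dist_mid w' CD; rewrite wE mulKg => /(dist_gen_sym Sr) DE.
have lw' : (len w' < n)%N by move: wn; rewrite lw ltnS.
have Nw'r : N w' s -> w' * r <> s * w'.
  move=> /cross_len + E'; rewrite -E' -wE lw.
  by rewrite ltnNge leqnSn.
have [C'E|C'E] := dist_step Ss CC' CE.
  have Nw' := IH _ _ lw' CE C'E.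
  rewrite crossM Nw' cross_gen //; apply/eqP => sr.
  by apply: Nw'r => //; rewrite -sr conjgE mulVKg.
have [C'E'|] := dist_stepr Sr DE C'D; last first.
  rewrite wE (gen_mulrK cox) // => /(dist_inj C'E) E'.
  by case: (gen_neq1 cox Ss); apply: (mulIg w'); rewrite E' mul1g.
have E' := dist_inj C'E' C'E; rewrite wE in E'.
by rewrite E' cross_genM //; apply/negP => /Nw'r.
Qed.

Lemma dist_increasing C C' D s w : S s -> dist C C' s -> dist C D w -> ~~ N w s ->
  dist C' D (s * w).
Proof.
move=> Ss CC' CD Nws; have [C'D|//] := dist_step Ss CC' CD.
by rewrite (cross_equidistant Ss CC' CD C'D) in Nws.
Qed.

(** Each letter of [v] either leaves the distance from [C] unchanged or is appended to it. The bound
    [k' <= k] serves to show that no letter is lost along a reduced word. *)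
Lemma dist_word J k v C D E x : J `<=` S -> word J k v -> dist C E x -> dist E D v ->
  exists k' v', [/\ (k' <= k)%N, word J k' v' & dist C D (x * v')].
Proof.
move=> JS kv; elim: kv x E => [|s {}k {}v Js _ IH] x E CE.
  by move=> /dist1 <-; exists 0, 1; split=> //; [exact: word_nil|rewrite mulg1].
move=> /(dist_mid s)[G EG]; rewrite mulKg => GD.
have [CG|CG] := dist_stepr (JS _ Js) EG CE.
  have [k' [v' [k'k kv' CD]]] := IH _ _ CG GD.
  by exists k', v'; split=> //; apply: leqW.
have [k' [v' [k'k kv' CD]]] := IH _ _ CG GD.
by exists k'.+1, (s * v'); split=> //; [exact: word_cons|rewrite mulgA].
Qed.

Lemma dist_residue J j C C' D w : J `<=` S -> generated J j -> dist C C' j ->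
  dist C D w -> exists2 i, generated J i & dist C' D (i * w).
Proof.
move=> JS /(generated_word cox JS)[k kj] CC' /dist_sym CD.
have [k' [v [_ /word_generated Jv]]] := dist_word JS kj CD CC'.
move=> /dist_sym; rewrite invgM invgK => C'D; exists v^-1 => //.
exact: generatedV.
Qed.

(* A minimal gallery from D0 to D stays on the side of the wall of C and C'
   away from C, so the projection to that panel cannot change along it. *)
Lemma dist_projection C C' D0 D s x u : S s -> dist C C' s ->
  dist C D0 x -> dist D0 D u -> dist C D (x * u) -> N x s -> N (x * u) s ->
  dist C' D0 (s * x) -> dist C' D (s * (x * u)).
Proof.
move=> Ss CC'; have [n] := ubnP (len u); elim: n D0 x u => // n IH D0 x u un.
have [->|/eqP u1] := eqVneq u 1.
  by move=> CD0 /dist1 <-; rewrite mulg1.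
have [t [v [St uE lu Nut]]] := left_descent cox u1.
move=> CD0 D0D CD Nx Nxu C'D0.
have [E D0E] := dist_mid t D0D; rewrite {1}uE mulKg => ED.
have Nxt : N (x * t) s.
  rewrite crossM Nx cross_gen //; apply/eqP => sx.
  by move: Nxu; rewrite crossM Nx sx Nut.
(* If this step left the distance at [x], then [D] would be reached from there by the shorter [v],
   giving a word for [u] of length below [len u]. *)
have CE : dist C E (x * t).
  have [CE|//] := dist_stepr St D0E CD0.
  have [k' [v' [k'v kv' CD']]] := dist_word (@subset_refl _ S) (word_len cox v) CE ED.
  have := leq_trans (len_le cox kv') k'v.
  by rewrite -(mulgI x _ _ (dist_inj CD CD')) lu ltnn.
have C'E : dist C' E (s * (x * t)).
  have [C'E|//] := dist_step Ss CC' CE.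
  have [C'E'|] := dist_stepr St D0E C'D0; last by rewrite mulgA.
  by move: Nxt; rewrite (dist_inj C'E C'E') cross_genM // Nx.
have xuE : x * u = x * t * v by rewrite uE mulgA.
rewrite xuE in CD Nxu *; apply: (IH E (x * t) v) => //.
by rewrite -ltnS -lu.
Qed.

(** [P] is the graph of a partial map from [W] to [T]: by [dist1], two members over the same [a]
    coincide. *)
Definition isometric P : Prop := forall a C b D,
  P (a, C) -> P (b, D) -> dist C D (a^-1 * b).

Lemma isometric_extend_by P a E : isometric P -> dist E E 1 ->
  (forall b D, P (b, D) -> dist E D (a^-1 * b)) -> isometric (P `|` [set (a, E)]).
Proof.
move=> Pi EE PE b C c D [PC|[-> ->]] [PD|[-> ->]].
- exact: Pi.
- by have /dist_sym := PE _ _ PC; rewrite invgM invgK.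
- exact: PE.
- by rewrite mulVg.
Qed.

(** If some [b0] of the domain lies across the [s]-panel of [a], the new chamber [E] is taken on the
    way from [C] to the image of [b0], and [dist_projection] shows that it suits every other such
    [b]. If there is none, any chamber [s]-adjacent to [C] works, by [dist_increasing]. *)
Lemma isometric_extend1 P a C s : isometric P -> P (a, C) -> S s ->
  exists E, isometric (P `|` [set (a * s, E)]).
Proof.
move=> Pi PC Ss; have CC : dist C C 1 by rewrite -(mulVg a); apply: Pi.
suff [E [CE PE]] : exists E, dist C E s /\
    forall b D, P (b, D) -> dist E D (s * (a^-1 * b)).
  exists E; apply: isometric_extend_by => //; first exact: dist_refll (dist_gen_sym Ss CE).
  by move=> b D; rewrite invgM (gen_inv cox Ss) -mulgA; apply: PE.
have [[b0 [D0 [P0 N0]]]|none] :=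
    pselect (exists b D, P (b, D) /\ N (a^-1 * b) s); last first.
  have [E CE _] := dist_mid s CC; exists E; split=> // b D PD.
  apply: dist_increasing (CE) (Pi _ _ _ _ PC PD) _ => //.
  by apply/negP => Nb; apply: none; exists b, D.
have [E CE ED0] := dist_mid s (Pi _ _ _ _ PC P0).
exists E; split=> // b D PD; have CD := Pi _ _ _ _ PC PD.
have [Nb|Nb] := boolP (N (a^-1 * b) s); last exact: dist_increasing CE CD Nb.
rewrite (gen_inv cox Ss) in ED0.
have bE : a^-1 * b = a^-1 * b0 * (b0^-1 * b) by rewrite -mulgA mulVKg.
rewrite bE; rewrite bE in CD Nb.
exact: dist_projection Ss CE (Pi _ _ _ _ PC P0) (Pi _ _ _ _ P0 PD) CD N0 Nb ED0.
Qed.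

Lemma isometric_extend P : P !=set0 -> isometric P ->
  exists f : W -> T, (forall a b, dist (f a) (f b) (a^-1 * b)) /\
    forall a C, P (a, C) -> f a = C.
Proof.
move=> [[a0 C0] P0] Pi.
(* Zorn's lemma runs over the set [M] added to [P], so that the empty chain simply adds nothing. *)
have [F chainP chainF|M [Mi Mmax]] :=
    @Zorn_bigcup (W * T) (fun M => isometric (P `|` M)).
  move=> a C b D [PC|[X FX XC]] [PD|[Y FY YD]].
  - exact: Pi.
  - by apply: (chainP _ FY); [left|right].
  - by apply: (chainP _ FX); [right|left].
  - by have [XY|YX] := chainF _ _ FX FY;
      [apply: (chainP _ FY)|apply: (chainP _ FX)]; right=> //;
      [apply: XY|apply: YX].
set R := P `|` M in Mi.
have Rs a C s : R (a, C) -> S s -> exists D, R (a * s, D).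
  move=> Ra Ss; apply: contrapT => nR.
  have [E Ei] := isometric_extend1 Mi Ra Ss.
  apply: (Mmax (M `|` [set (a * s, E)])); last by rewrite setUA.
  split; first by move=> ? ?; left.
  by move=> /(_ (a * s, E))H; apply: nR; exists E; right; apply: H; right.
(* The domain of [R] contains [a0] and is stable under right multiplication by generators, so it is
   all of [W]. *)
have Rtot w : exists C, R (w, C).
  rewrite -[w](mulVKg a0); have : R (a0, C0) by left.
  have [_ Sgen _] := cox; have : generated S (a0^-1 * w) by rewrite Sgen.
  move=> /(generated_word cox)[]// k.
  move: (a0^-1 * w) => u ku; move: a0 C0 {P0}.
  elim: ku => [|s {}k {}u Ss _ IH] a C Ra; first by exists C; rewrite mulg1.
  by have [D Rb] := Rs _ _ _ Ra Ss; rewrite mulgA; apply: IH Rb.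
have [f fP] := choice Rtot; exists f; split=> [a b|a C PC]; first exact: Mi.
by apply: dist1; rewrite -(mulVg a); apply: Mi => //; left.
Qed.

End WeylDistance.

(** * Cosets of parabolic subgroups *)

Section Cosets.
Variable W : groupType.
Implicit Types (w : W) (J : set W).

Definition coset w J : set W := [set w * u | u in generated J].

Lemma cosetE w J w' : coset w J w' <-> generated J (w^-1 * w').
Proof.
split=> [[u Ju <-]|Jw]; first by rewrite mulKg.
by exists (w^-1 * w'); rewrite ?mulVKg.
Qed.

Lemma coset_self w J : coset w J w.
Proof. by apply/cosetE; rewrite mulVg; apply: generated1. Qed.

Lemma coset_eq w w' J : generated J (w^-1 * w') -> coset w J = coset w' J.
Proof.
move=> Jw; apply/seteqP; split=> x /cosetE Jx; apply/cosetE.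
  rewrite -[x](mulVKg w) mulgA; apply: generatedM => //.
  by rewrite -[_ * w]invgK invgM invgK; apply: generatedV.
by rewrite -[x](mulVKg w') mulgA; apply: generatedM.
Qed.

Lemma coset_sub w J K : J `<=` generated K -> coset w J `<=` coset w K.
Proof.
move=> JK x /cosetE Jx; apply/cosetE; move: Jx.
by apply: generated_ind => //; [exact: generated1|exact: generatedF].
Qed.
End Cosets.

(** * Charts: coordinates on Coxeter complexes *)

Section Charts.
Variables (W : groupType) (S : set W) (V : Type).
Hypothesis cox : coxeter_system S.
Implicit Types (X : set (set V)) (F : W -> W -> V) (w s : W).

(* [F w s] is the vertex of type [s] of the chamber [w]. *)
Definition chart X F : Prop :=
  (forall w w' s s', S s -> S s' ->
     F w s = F w' s' <-> s = s' /\ generated (S `\ s) (w^-1 * w')) /\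
  (forall A, X A <-> exists w, A `<=` F w @` S).

Lemma generated_setD1 J K : J `<=` S -> K `<=` S -> J `<=` generated K -> J `<=` K.
Proof.
move=> JS KS JK s Js; apply: (generated_gen cox) => //; first exact: JS.
exact: JK.
Qed.

Lemma subsetD1_eq s r : S s -> S r -> S `\ s `<=` S `\ r -> s = r.
Proof. by move=> Ss Sr sub; apply: contrapT => sr; have [//|_ []] := sub r; split=> // /esym. Qed.

Lemma not_generated_setD1 s : S s -> ~ generated (S `\ s) s.
Proof.
move=> Ss /(generated_gen cox)[]//; first by move=> ? [].
Qed.

(** The correspondence with cosets reverses inclusion, so vertices match the maximal proper cosets,
    those of the subgroups generated by [S] minus one [s]. [v0] is a default value of the chart at
    types outside [S]. *)
Lemma isomorphic_chart X (v0 : V) : simplicial_complex X ->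
  isomorphic_coxeter_complex S X -> exists F, chart X F.
Proof.
move=> [X0 _ Xsub] [phi [[phiX _ phis] ord]].
have subS s : S `\ s `<=` S by move=> ? [].
have phi_surj w J : J `<=` S -> exists A, X A /\ phi A = coset w J.
  by move=> JS; have [|A XA <-] := phis (coset w J); [exists w, J|exists A].
have phi_coset A w : X A -> phi A w -> exists J, J `<=` S /\ phi A = coset w J.
  move=> /phiX[w' [J [JS ->]]] /cosetE Jw; exists J; split => //.
  exact: coset_eq.
have phiT A : X A -> phi A = setT -> A = set0.
  move=> XA At; apply/seteqP; split=> //.
  by apply/(ord _ _ XA X0); rewrite At.
have phi_inj A B : X A -> X B -> phi A = phi B -> A = B.
  move=> XA XB AB; apply/seteqP.
  by split; [apply/(ord _ _ XA XB)|apply/(ord _ _ XB XA)]; rewrite AB.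
have phi_max A w : X A -> A !=set0 -> phi A w ->
    exists2 s, S s & phi A `<=` coset w (S `\ s).
  move=> XA [v Av] Aw; have [J [JS AJ]] := phi_coset _ _ XA Aw.
  have [[s [Ss nJs]]|SJ] := pselect (exists s, S s /\ ~ J s).
    exists s => //; rewrite AJ; apply: coset_sub => r Jr.
    by apply: generated_sub; split; [exact: JS|move=> /= rs; apply: nJs; rewrite -rs].
  suff : v \in set0 by rewrite inE.
  rewrite inE -(phiT _ XA) // AJ; apply/seteqP; split=> // x _; apply/cosetE.
  have [_ Sgen _] := cox; have : generated S (w^-1 * x) by rewrite Sgen.
  by apply: generatedS => r Sr; apply: contrapT => nJr; apply: SJ; exists r.
have phi_vertex w s : S s -> exists v, X [set v] /\ phi [set v] = coset w (S `\ s).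
  move=> Ss; have [A [XA AE]] := phi_surj w _ (@subS s).
  have [A0|/set0P[v Av]] := eqVneq A set0.
    have [A' [XA' A'E]] := phi_surj 1 _ (@subset_refl _ S).
    have /(ord _ _ XA XA')/(_ (w * s)) : A `<=` A' by rewrite A0.
    rewrite AE A'E => H; have /H /cosetE : coset 1 S (w * s).
      by apply/cosetE; rewrite invg1 mul1g; case: cox => _ -> _.
    by rewrite mulKg => /not_generated_setD1.
  have vA : [set v] `<=` A by move=> _ ->.
  have Xv := Xsub _ _ XA vA; exists v; split => //.
  have Av' := (ord _ _ Xv XA).1 vA.
  have vw : phi [set v] w by apply: Av'; rewrite AE; apply: coset_self.
  (* The coset of the vertex [v] contains that of [A] and lies in a maximal proper one, which forces
     all three to coincide. *)
  have [|r Sr vr] := phi_max _ _ Xv _ vw; first by exists v.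
  have rs : s = r.
    apply: subsetD1_eq => //; apply: generated_setD1 => //.
    move=> t ts; have /(subset_trans Av')/(_ (w * t)) := vr.
    rewrite AE => H; rewrite -[t](mulKg w); apply/cosetE/H/cosetE; rewrite mulKg.
    exact: generated_sub.
  by apply/seteqP; split; [rewrite rs|rewrite -AE].
have /choice[F FP] : forall ws : W * W, exists v, S ws.2 ->
    X [set v] /\ phi [set v] = coset ws.1 (S `\ ws.2).
  move=> [w s] /=; have [Ss|nSs] := pselect (S s); last by exists v0.
  by have [v] := phi_vertex w s Ss; exists v.
exists (fun w s => F (w, s)); split=> [w w' s s' Ss Ss'|A].
  have [/= Xv Ev] := FP (w, s) Ss; have [/= Xv' Ev'] := FP (w', s') Ss'.
  split=> [E|[<- ww']]; last first.
    suff : [set F (w, s)] = [set F (w', s)] by move=> /seteqP[/(_ _ erefl)].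
    have [/= Xv'' Ev''] := FP (w', s) Ss.
    by apply: phi_inj => //; rewrite Ev Ev''; apply: coset_eq.
  have ww' : generated (S `\ s) (w^-1 * w').
    by apply/cosetE; rewrite -Ev E Ev'; apply: coset_self.
  split=> //; apply: subsetD1_eq => //; apply: generated_setD1 => // t ts.
  rewrite -[t](mulKg w'); apply/cosetE; rewrite -Ev' -E Ev; apply/cosetE.
  by rewrite mulgA; apply: generatedM => //; apply: generated_sub.
split=> [XA|[w Aw]]; last first.
  have [C [XC CE]] := phi_surj w _ (@sub0set _ S).
  apply: (Xsub _ _ XC) => v /Aw[s Ss <-].
  have [/= Xv Ev] := FP (w, s) Ss.
  suff : [set F (w, s)] `<=` C by apply.
  apply/(ord _ _ Xv XC); rewrite CE Ev; apply: coset_sub => //.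
have [w [J [JS AE]]] := phiX _ XA; exists w => v Av.
have vA : [set v] `<=` A by move=> _ ->.
have Xv := Xsub _ _ XA vA; have vw : phi [set v] w.
  by apply: (ord _ _ Xv XA).1 => //; rewrite AE; apply: coset_self.
have [|s Ss vs] := phi_max _ _ Xv _ vw; first by exists v.
have [/= Xv' Ev'] := FP (w, s) Ss; exists s => //.
suff : [set F (w, s)] `<=` [set v] by apply.
by apply/(ord _ _ Xv' Xv); rewrite Ev'.
Qed.

Lemma chart_type X F w w' s s' : chart X F -> S s -> S s' -> F w s = F w' s' -> s = s'.
Proof. by move=> [FE _] Ss Ss' /FE[]. Qed.

(** Sharing the vertex of type [s] means differing by the subgroup generated by [S] minus [s]; over
    all [s] outside [J], these subgroups intersect in [generated J]. *)
Lemma chart_cap X F J w w' : chart X F -> J `<=` S ->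
  (forall s, S s -> ~ J s -> F w s = F w' s) <-> generated J (w^-1 * w').
Proof.
move=> [FE _] JS; split=> [H|Jw s Ss nJs].
  apply: (generated_cap cox) => // s Ss nJs.
  by have /FE[] := H s Ss nJs.
apply/FE => //; split => //; apply: generatedS Jw => r Jr.
by split; [exact: JS|move=> E; apply: nJs; rewrite -E].
Qed.

(** A simplex corresponds to the set of chambers containing it, which is a coset of the subgroup
    generated by its cotype. *)
Lemma chart_isomorphic X F : chart X F -> isomorphic_coxeter_complex S X.
Proof.
move=> Fch; have [FE FX] := Fch.
pose phi A := [set w | A `<=` F w @` S].
pose cotype A w := [set s | S s /\ ~ A (F w s)].
have cotS A w : cotype A w `<=` S by move=> ? [].
have phiE A w : A `<=` F w @` S -> phi A = coset w (cotype A w).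
  move=> Aw; apply/seteqP; split=> w'.
    move=> Aw'; apply/cosetE/(chart_cap _ _ Fch) => // s Ss /not_andP[//|/contrapT AF].
    have [r Sr E] := Aw' _ AF; have /FE[//|//|rs _] := E.
    by rewrite -E rs.
  move=> /cosetE/(chart_cap _ _ Fch (cotS _ _)) H v Av; have [s Ss E] := Aw _ Av.
  by exists s => //; rewrite -H // => -[_]; rewrite E.
have ord A B : X A -> X B -> A `<=` B <-> phi B `<=` phi A.
  move=> XA XB; split=> [AB w Bw|BA]; first exact: subset_trans Bw.
  have [w Bw] := (FX B).1 XB; have Aw : phi A w by apply: BA.
  move=> v Av; have [s Ss E] := Aw _ Av; apply: contrapT => nBv.
  have : phi B (w * s).
    rewrite (phiE _ _ Bw); apply/cosetE; rewrite mulKg; apply: generated_sub.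
    by split=> //; rewrite E.
  move=> /BA/(_ _ Av)[r Sr]; rewrite -E => /FE[//|//|-> ].
  by rewrite invgM mulgVK => /generatedV; rewrite invgK => /not_generated_setD1.
exists phi; split=> //; split.
- move=> A /FX[w Aw]; exists w, (cotype A w); split=> //; exact: phiE.
- move=> A B /set_mem XA /set_mem XB AB.
  by apply/seteqP; split; [apply/ord|apply/ord]; rewrite ?AB.
- move=> _ [w [J [JS ->]]]; pose A := F w @` (S `\` J).
  have Aw : A `<=` F w @` S by move=> _ [s [Ss _] <-]; exists s.
  exists A; first by apply/FX; exists w.
  rewrite (phiE _ _ Aw); congr (coset w _); apply/seteqP; split=> s.
    by move=> [Ss nA]; apply: contrapT => nJ; apply: nA; exists s.
  move=> Js; split=> [|[r [Sr nJr] /FE[//|//|rs _]]]; first exact: JS.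
    exact: JS.
  by apply: nJr; rewrite rs.
Qed.

Lemma chart_simplex X F w : chart X F -> X (F w @` S).
Proof. by move=> [_ FX]; apply/FX; exists w. Qed.

Lemma chart_translate X F a : chart X F -> chart X (fun w => F (a * w)).
Proof.
move=> [FE FX]; split=> [w w' s s' Ss Ss'|A].
  by rewrite FE // invgM -mulgA mulKg.
rewrite FX; split=> [[w Aw]|[w Aw]]; last by exists (a * w).
by exists (a^-1 * w); rewrite mulVKg.
Qed.

Lemma vertices_chart X F : chart X F ->
  vertices X = [set v | exists w s, S s /\ F w s = v].
Proof.
move=> [_ FX]; apply/seteqP; split=> v.
  by move=> /FX[w /(_ v erefl)[s Ss <-]]; exists w, s.
by move=> [w [s [Ss <-]]]; apply/FX; exists w => _ ->; exists s.
Qed.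

Lemma chart_comp X Y F h : (forall A B, Y A -> B `<=` A -> Y B) ->
  chart X F -> simplicial_isomorphism X Y h -> chart Y (fun w s => h (F w s)).
Proof.
move=> Ysub Fch [hbij hX]; have [FE FX] := Fch; have [hV hinj hsurj] := hbij.
have FV w s : S s -> vertices X (F w s).
  by move=> Ss; rewrite (vertices_chart Fch); exists w, s.
split=> [w w' s s' Ss Ss'|B].
  by rewrite -FE //; split=> [|-> //]; apply: hinj; apply/mem_set/FV.
split=> [YB|[w Bw]].
  pose A := vertices X `&` h @^-1` B.
  have hA : h @` A = B.
    apply/seteqP; split=> [_ [v [_ Bv] <-] //|b Bb].
    have /hsurj[v Xv vb] : vertices Y b by apply: (Ysub _ _ YB) => _ ->.
    by exists v => //; split=> //=; rewrite vb.
  have /FX[w Aw] : X A by apply/hX; [move=> ? []|rewrite hA].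
  by exists w; rewrite -hA => _ [v /Aw[s Ss <-] <-]; exists s.
apply: (Ysub (h @` (F w @` S))).
  apply/hX; last by apply: (chart_simplex _ Fch).
  by move=> _ [s Ss <-]; apply: FV.
by move=> b /Bw[s Ss <-]; exists (F w s) => //; exists s.
Qed.

Lemma charts_isomorphism X Y F G : chart X F -> chart Y G ->
  exists2 h, simplicial_isomorphism X Y h & forall w s, S s -> h (F w s) = G w s.
Proof.
move=> Fch Gch; have [FE FX] := Fch; have [GE GX] := Gch.
have /choice[h hP] : forall v, exists u, forall w s, S s -> F w s = v -> G w s = u.
  move=> v; have [[w [s [Ss <-]]]|nv] := pselect (exists w s, S s /\ F w s = v).
    by exists (G w s) => w' s' Ss' /FE[//|//|ss' Jw]; apply/GE.
  by exists v => w s Ss E; case: nv; exists w, s.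
have hF w s : S s -> h (F w s) = G w s by move=> Ss; rewrite -(hP _ w s Ss erefl).
exists h => //; rewrite /simplicial_isomorphism (vertices_chart Fch) (vertices_chart Gch).
split=> [|A AV].
  split=> [_ [w [s [Ss <-]]]|_ _ /set_mem[w [s [Ss <-]]] /set_mem[w' [s' [Ss' <-]]]|
      _ [w [s [Ss <-]]]].
  - by exists w, s; rewrite hF.
  - by rewrite !hF // => /GE[//|//|ss' Jw]; apply/FE.
  - by exists (F w s); rewrite ?hF //; exists w, s.
split=> [/FX[w Aw]|/GX[w Aw]].
  apply/GX; exists w => _ [v /Aw[s Ss <-] <-].
  by exists s; rewrite ?hF.
apply/FX; exists w => v Av; have [w' [s' [Ss' E]]] := AV _ Av.
have [|s Ss] := Aw (h v); first by exists v.
by rewrite -E hF // => /GE[//|//|ss' Jw]; exists s => //; apply/FE.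
Qed.

(* A thin complex has no nontrivial automorphism fixing a chamber pointwise. *)
Lemma chart_rigid X F G a : chart X F -> chart X G ->
  (forall s, S s -> F a s = G a s) -> forall w s, S s -> F w s = G w s.
Proof.
move=> Fch Gch FGa.
have step b t : S t -> (forall s, S s -> F b s = G b s) ->
    forall s, S s -> F (b * t) s = G (b * t) s.
  move=> St FGb; have tS : [set t] `<=` S by move=> _ ->.
  have adj H : chart X H -> forall s, S s -> s <> t -> H b s = H (b * t) s.
    move=> Hch; apply/(chart_cap _ _ Hch tS); rewrite mulKg.
    exact: generated_sub.
  (* [w] is the position in [F] of the chamber [b * t] of [G]. It shares with [b] the panel of
     cotype [t], so it is [b] or [b * t], and [b] is excluded. *)
  have [w Gw] := (Fch.2 _).1 (chart_simplex (b * t) Gch).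
  have FG s : S s -> exists2 r, S r & F w r = G (b * t) s.
    by move=> Ss; apply: Gw; exists s.
  have /(chart_cap _ _ Fch tS)/(generated_set1 cox St)[] :
      forall s, S s -> ~ [set t] s -> F b s = F w s.
    move=> s Ss st; have [r Sr] := FG s Ss.
    rewrite -(adj _ Gch) // -FGb // => E.
    by rewrite -E (chart_type Fch Sr Ss E).
  - move=> bw; have wb : w = b by rewrite -[w](mulVKg b) bw mulg1.
    have [r Sr] := FG t St; rewrite wb FGb // => E.
    have rt := chart_type Gch Sr St E; move: E; rewrite rt => /(Gch.1 _ _ _ _ St St)[_].
    by rewrite mulKg => /(not_generated_setD1 St).
  - move=> bw s Ss; have wb : w = b * t by rewrite -[w](mulVKg b) bw.
    have [->|/eqP st] := eqVneq s t; last by rewrite -!adj // FGb.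
    have [r Sr] := FG t St; rewrite wb.
    have [->//|/eqP rt] := eqVneq r t.
    by rewrite -(adj _ Fch) // FGb // => /(chart_type Gch Sr St).
move=> w s Ss; rewrite -[w](mulVKg a).
have [_ Sgen _] := cox; have : generated S (a^-1 * w) by rewrite Sgen.
move=> /(generated_word cox)[]// k.
move: (a^-1 * w) => u ku; elim: ku a FGa => [|t {}k {}u St _ IH] b FGb.
  by rewrite mulg1; apply: FGb.
by rewrite mulgA; apply: IH; apply: step.
Qed.
End Charts.

(** * Types of vertices and labelled apartments *)

Section Labelling.
Variables (W : groupType) (S : set W) (V : Type).
Variables (Delta : set (set V)) (Aps : set (set (set V))).
Hypothesis cox : coxeter_system S.
Hypothesis apt : apartment_system S Delta Aps.
Variables (X0 : set (set V)) (F0 : W -> W -> V).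
Hypothesis AX0 : Aps X0.
Hypothesis F0ch : chart S X0 F0.
Implicit Types (X : set (set V)) (A B C D E : set V) (F G : W -> W -> V) (w s : W).

Lemma apt_sub X A : Aps X -> X A -> Delta A.
Proof. by case: apt => H _ _ /H[[_ ]] sub _; apply: sub. Qed.

Lemma apt_closed X A B : Aps X -> X A -> B `<=` A -> X B.
Proof. by case: apt => H _ _ /H[[[_ _ ]]] sub _ _; apply: sub. Qed.

Lemma apt_join A B : Delta A -> Delta B -> exists2 X, Aps X & X A /\ X B.
Proof. by case: apt => _ + _; apply. Qed.

Lemma apt_iso X X' A B : Aps X -> Aps X' -> X A -> X B -> X' A -> X' B ->
  exists2 f, simplicial_isomorphism X X' f & forall v, (A `|` B) v -> f v = v.
Proof. by case: apt => _ _; apply. Qed.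

Lemma apt_chart X : Aps X -> exists F, chart S X F.
Proof.
case: apt => H _ _ AX; have [[Xs _] Xi] := H _ AX.
exact: (isomorphic_chart cox (F0 1 1) Xs Xi).
Qed.

Lemma chart_maximal X F w A : chart S X F -> X A -> F w @` S `<=` A -> A = F w @` S.
Proof.
move=> Fch XA wA; apply/seteqP; split=> //.
have [w' Aw'] := (Fch.2 _).1 XA.
suff ww' : w = w' by rewrite ww'.
rewrite -[w'](mulVKg w).
rewrite (@generated0 _ _ cox (w^-1 * w')) ?mulg1 //.
apply/(chart_cap cox _ _ Fch (@sub0set _ _)) => s Ss _.
have [|r Sr E] := Aw' (F w s); first by apply: wA; exists s.
by rewrite -E (chart_type Fch Sr Ss E).
Qed.

Definition based X F : Prop :=
  [/\ Aps X, chart S X F & forall s, S s -> F 1 s = F0 1 s].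

(* Types are transported from the chart [F0] of the base apartment through the
   apartments that contain the base chamber [F0 1 @` S]. *)
Definition has_type (v : V) s : Prop :=
  S s /\ exists X F w, based X F /\ v = F w s.

(** An isomorphism between the two apartments that fixes the base chamber and [v] matches the two
    charts by rigidity. *)
Lemma has_type_inj v s s' : has_type v s -> has_type v s' -> s = s'.
Proof.
move=> [Ss [X [F [w [[AX Fch F1] vE]]]]] [Ss' [X' [F' [w' [[AX' Fch' F1'] vE']]]]].
have F1E : F 1 @` S = F' 1 @` S.
  by apply: eq_imagel => r Sr; rewrite F1 ?F1'.
have Xv : X [set v] by apply/Fch.2; exists w => _ ->; exists s.
have Xv' : X' [set v] by apply/Fch'.2; exists w' => _ ->; exists s'.
have [||h hiso hfix] := @apt_iso X X' (F 1 @` S) [set v] AX AX' _ Xv _ Xv'.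
- exact: chart_simplex Fch.
- by rewrite F1E; apply: chart_simplex Fch'.
have hch := chart_comp (fun A B => @apt_closed X' A B AX') Fch hiso.
have hF1 r : S r -> h (F 1 r) = F' 1 r.
  by move=> Sr; rewrite hfix; [rewrite F1 ?F1'|left; exists r].
have := chart_rigid cox hch Fch' hF1 w Ss.
by rewrite hfix -?vE; [rewrite vE' => /(chart_type Fch' Ss' Ss)|right].
Qed.

Lemma based_exists A : Delta A -> exists X F w, based X F /\ A `<=` F w @` S.
Proof.
move=> DA; have X0C := chart_simplex 1 F0ch.
have [X AX [XA XC]] := apt_join DA (apt_sub AX0 X0C).
have [h hiso hfix] := apt_iso AX0 AX X0C X0C XC XC.
have hch := chart_comp (fun A B => @apt_closed X A B AX) F0ch hiso.
have [w Aw] := (hch.2 _).1 XA.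
exists X, (fun w s => h (F0 w s)), w; split=> //; split=> // s Ss.
by apply: hfix; left; exists s.
Qed.

Definition typed F : Prop := forall w s, S s -> has_type (F w s) s.

Definition labelled X F : Prop := [/\ Aps X, chart S X F & typed F].

(** An apartment through the base chamber and one chamber of [X] yields a chart of [X] with the
    right types at that chamber; the types then spread across panels. *)
Lemma labelled_exists X : Aps X -> exists F, labelled X F.
Proof.
move=> AX; have [G Gch] := apt_chart AX; have XD := chart_simplex 1 Gch.
have [X1 [F1 [w1 [[AX1 F1ch F11] DF1]]]] := based_exists (apt_sub AX XD).
have X1E := chart_simplex w1 F1ch; have X1D := apt_closed AX1 X1E DF1.
have [h hiso hfix] := apt_iso AX1 AX X1D X1D XD XD.
pose H w s := h (F1 w s).
have Hch : chart S X H := chart_comp (fun A B => @apt_closed X A B AX) F1ch hiso.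
have F1D s : S s -> (G 1 @` S) (F1 w1 s).
  move=> Ss; have HD : H w1 @` S = G 1 @` S.
    apply: (chart_maximal Gch); first exact: chart_simplex Hch.
    move=> v Dv; have [r Sr vE] := DF1 _ Dv; exists r => //.
    by rewrite /H vE hfix //; left.
  have : (G 1 @` S) (H w1 s) by rewrite -HD; exists s.
  move=> Dh; have [r Sr E] := DF1 _ Dh.
  have : H w1 r = H w1 s by rewrite -E /H E hfix //; left.
  by move=> /(chart_type Hch Sr Ss) <-; rewrite E.
exists H; split=> //.
have Hw1 s : S s -> has_type (H w1 s) s.
  move=> Ss; rewrite /H hfix; last by left; apply: F1D.
  by split=> //; exists X1, F1, w1.
(* The vertices on the panel keep their types, and the new vertex takes the only type left, namely
   [t]. *)
have step w t : S t -> (forall s, S s -> has_type (H w s) s) ->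
    forall s, S s -> has_type (H (w * t) s) s.
  move=> St Hw; have adj : forall s, S s -> s <> t -> H w s = H (w * t) s.
    have tS : [set t] `<=` S by move=> _ ->.
    apply/(chart_cap cox _ _ Hch tS); rewrite mulKg.
    exact: generated_sub.
  have [X2 [F2 [w2 [F2b DF2]]]] := based_exists (apt_sub AX (chart_simplex (w * t) Hch)).
  move=> s Ss; have [->|/eqP st] := eqVneq s t; last by rewrite -adj //; apply: Hw.
  have typ r : S r -> exists r', [/\ has_type (H (w * t) r) r', S r' & F2 w2 r' = H (w * t) r].
    move=> Sr; have [|r' Sr' E] := DF2 (H (w * t) r); first by exists r.
    by exists r'; split => //; split=> //; exists X2, F2, w2.
  have [r [tyr Sr Er]] := typ t St.
  have [rt|/eqP rt] := eqVneq r t; first by rewrite -{3}rt.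
  have [r' [tyr' Sr' Er']] := typ r Sr; move: tyr' Er'; rewrite -adj // => tyr'.
  rewrite (has_type_inj tyr' (Hw _ Sr)) Er adj // => E.
  by case: rt; rewrite (chart_type Hch St Sr E).
move=> w s Ss; rewrite -[w](mulVKg w1).
have [_ Sgen _] := cox; have : generated S (w1^-1 * w) by rewrite Sgen.
move=> /(generated_word cox)[]// k.
move: (w1^-1 * w) => u ku; elim: ku w1 Hw1 {X1E DF1 F1D} => [|t {}k {}u St _ IH] b Hb.
  by rewrite mulg1; apply: Hb.
by rewrite mulgA; apply: IH; apply: step.
Qed.

Lemma typed_mem F G a b s : typed F -> typed G -> S s -> (G b @` S) (F a s) ->
  F a s = G b s.
Proof.
move=> Fty Gty Ss [r Sr E].
by rewrite -E (has_type_inj (Fty a s Ss) (s' := r)) // -E; apply: Gty.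
Qed.

Lemma typed_sub F G a b : typed F -> typed G -> F a @` S `<=` G b @` S ->
  forall s, S s -> F a s = G b s.
Proof. by move=> Fty Gty FG s Ss; apply: typed_mem => //; apply: FG; exists s. Qed.

Lemma labelled_typed X F : labelled X F -> typed F.
Proof. by case. Qed.

(** By rigidity, the isomorphism fixing the common chamber and [B] matches the two charts recentred
    at that chamber, so vertices of [B] have the same position relative to it in both apartments. *)
Lemma labelled_transport X F X' F' d d' B : labelled X F -> labelled X' F' ->
  F d @` S = F' d' @` S -> X B -> X' B ->
  forall w s, S s -> B (F (d * w) s) -> F (d * w) s = F' (d' * w) s.
Proof.
move=> lF lF' dE XB XB' w s Ss Bs; have [AX Fch _] := lF; have [AX' Fch' _] := lF'.
have Xd := chart_simplex d Fch; have Xd' := chart_simplex d' Fch'.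
rewrite -dE in Xd'.
have [h hiso hfix] := apt_iso AX AX' Xd XB Xd' XB'.
have hch := chart_comp (fun A B => @apt_closed X' A B AX') Fch hiso.
have hd r : S r -> h (F (d * 1) r) = F' (d' * 1) r.
  move=> Sr; rewrite !mulg1 hfix; last by left; exists r.
  by apply: (typed_sub (labelled_typed lF) (labelled_typed lF')) => //; rewrite dE.
have := chart_rigid cox (chart_translate d hch) (chart_translate d' Fch') hd w Ss.
by rewrite hfix //; right.
Qed.

(** * The Weyl distance of the building and isometric images of [W] *)

Definition building_chamber C : Prop :=
  exists X F w, labelled X F /\ C = F w @` S.

(** The Weyl distance, kept as a relation since it makes sense only between chambers; [dist_inj] is
    its independence of the apartment. *)
Definition dist C D w : Prop :=
  exists X F a, [/\ labelled X F, C = F a @` S & D = F (a * w) @` S].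

Lemma dist_inj C D w w' : dist C D w -> dist C D w' -> w = w'.
Proof.
move=> [X [F [a [lF -> ->]]]] [X' [F' [a' [lF' aE awE]]]].
have [_ Fch _] := lF; have [_ Fch' _] := lF'.
have XB := chart_simplex (a * w) Fch; have XB' := chart_simplex (a' * w') Fch'.
rewrite -awE in XB'.
have T := labelled_transport lF lF' aE XB XB' (w := w).
suff E : (a' * w)^-1 * (a' * w') = 1.
  by apply: (mulgI a'); rewrite -[RHS](mulVKg (a' * w)) E mulg1.
apply: (generated0 cox); apply/(chart_cap cox _ _ Fch' (@sub0set _ _)) => s Ss _.
rewrite -T; [|by []|by exists s].
by apply: (typed_sub (labelled_typed lF) (labelled_typed lF')) => //; rewrite awE.
Qed.

Lemma dist_chamberl C D w : dist C D w -> building_chamber C.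
Proof. by move=> [X [F [a [lF -> _]]]]; exists X, F, a. Qed.

Lemma dist_sym C D w : dist C D w -> dist D C w^-1.
Proof. by move=> [X [F [a [lF -> ->]]]]; exists X, F, (a * w); rewrite mulgK. Qed.

Lemma dist_chamberr C D w : dist C D w -> building_chamber D.
Proof. by move=> /dist_sym/dist_chamberl. Qed.

Lemma dist_refl C : building_chamber C -> dist C C 1.
Proof. by move=> [X [F [a [lF ->]]]]; exists X, F, a; rewrite mulg1. Qed.

Lemma dist1 C D : dist C D 1 -> C = D.
Proof. by move=> [X [F [a [_ -> ->]]]]; rewrite mulg1. Qed.

Lemma chamber_sub C A : building_chamber C -> A `<=` C -> Delta A.
Proof.
move=> [X [F [w [[AX Fch _] ->]]]] AC; apply: (apt_sub AX).
exact: apt_closed AX (chart_simplex w Fch) AC.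
Qed.

Lemma labelled_chamber X F C : building_chamber C -> labelled X F -> X C ->
  exists w, C = F w @` S.
Proof.
move=> [X' [F' [w' [lF' ->]]]] lF; have [_ Fch _] := lF => /Fch.2[w sub].
by exists w; apply: eq_imagel => s Ss; apply: (typed_sub (labelled_typed lF') (labelled_typed lF)).
Qed.

Lemma labelled_dist X F a b : labelled X F -> dist (F a @` S) (F b @` S) (a^-1 * b).
Proof. by move=> lF; exists X, F, a; rewrite mulVKg. Qed.

Lemma apt_join_labelled A B : Delta A -> Delta B ->
  exists X F, [/\ labelled X F, X A & X B].
Proof.
move=> DA DB; have [X AX [XA XB]] := apt_join DA DB.
by have [F lF] := labelled_exists AX; exists X, F.
Qed.

Lemma dist_total C D : building_chamber C -> building_chamber D -> exists w, dist C D w.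
Proof.
move=> cC cD.
have [X [F [lF XC XD]]] := apt_join_labelled
  (chamber_sub cC (@subset_refl _ _)) (chamber_sub cD (@subset_refl _ _)).
have [a ->] := labelled_chamber cC lF XC; have [b ->] := labelled_chamber cD lF XD.
by exists (a^-1 * b); apply: (labelled_dist _ _ lF).
Qed.

(** An apartment through [C], [D] and one through [C'], [D] both contain [D] and the panel shared by
    [C] and [C']. Seen from [D] this panel has the same position in both, so [w^-1] and [w'^-1] lie
    in one coset of the subgroup generated by [s]. *)
Lemma dist_step C C' D s w : S s -> dist C C' s -> dist C D w ->
  dist C' D w \/ dist C' D (s * w).
Proof.
move=> Ss CC' CD; have [w' C'D] := dist_total (dist_chamberr CC') (dist_chamberr CD).
suff : w * w'^-1 = 1 \/ w * w'^-1 = s.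
  move=> [/divg1_eq ->|ws]; first by left.
  by right; rewrite -(mulgVK w' w) ws (gen_mulK cox).
have [X [F [a [lF Ca Daw]]]] := CD; have [X' [F' [a' [lF' Ca' Daw']]]] := C'D.
have [_ Fch _] := lF; have [_ Fch' _] := lF'.
have [X2 [F2 [a2 [lF2 Ca2 Ca2']]]] := CC'; have [_ F2ch _] := lF2.
have sS : [set s] `<=` S by move=> _ ->.
have panelE r : S r -> r <> s -> F a r = F' a' r.
  move=> Sr rs.
  rewrite (typed_sub (labelled_typed lF) (labelled_typed lF2) (b := a2)) // -?Ca -?Ca2 //.
  rewrite (typed_sub (labelled_typed lF') (labelled_typed lF2) (b := a2 * s)) // -?Ca' -?Ca2' //.
  move: r Sr rs; apply/(chart_cap cox _ _ F2ch sS); rewrite mulKg.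
  exact: generated_sub.
pose P := F a @` (S `\ s).
have XP : X P.
  by apply/Fch.2; exists a => _ [r [Sr _] <-]; exists r.
have XP' : X' P.
  by apply/Fch'.2; exists a' => _ [r [Sr rs] <-]; exists r; rewrite ?panelE.
have DE : F (a * w) @` S = F' (a' * w') @` S by rewrite -Daw.
apply: (generated_set1 cox Ss).
rewrite (_ : w * w'^-1 = (a' * w' * w^-1)^-1 * a'); last first.
  by rewrite !invgM invgK !mulgA mulgVK.
apply/(chart_cap cox _ _ Fch' sS) => r Sr rs.
rewrite -panelE //.
have := labelled_transport lF lF' DE XP XP' (w := w^-1) Sr.
by rewrite mulgK => <- //; exists r.
Qed.

Lemma dist_mid C D w u : dist C D w -> exists2 E, dist C E u & dist E D (u^-1 * w).
Proof.
move=> [X [F [a [lF -> ->]]]]; exists (F (a * u) @` S); exists X, F.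
  by exists a.
by exists (a * u); split=> //; rewrite mulgA mulgK.
Qed.

Lemma typed_chamber C : building_chamber C -> exists F w, typed F /\ C = F w @` S.
Proof. by move=> [X [F [w [[_ _ Fty] ->]]]]; exists F, w. Qed.

Lemma dist_face F G a b w J : typed F -> typed G -> J `<=` S ->
  dist (F a @` S) (G b @` S) w ->
  (forall s, S s -> ~ J s -> F a s = G b s) <-> generated J w.
Proof.
move=> Fty Gty JS [X [H [c [[_ Hch Hty] aE bE]]]].
have -> : w = c^-1 * (c * w) by rewrite mulKg.
rewrite -(chart_cap cox c (c * w) Hch JS).
by split=> FG s Ss nJs; have := FG s Ss nJs;
  rewrite (typed_sub Fty Hty (b := c)) ?aE // (typed_sub Gty Hty (b := c * w)) ?bE.
Qed.

(** The analogue of [labelled] with isometry in place of membership in [Aps]; membership is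
    recovered in [isometric_chart_apartment]. *)
Definition isometric_chart X F : Prop :=
  [/\ chart S X F, typed F & forall a b, dist (F a @` S) (F b @` S) (a^-1 * b)].

Lemma labelled_isometric X F : labelled X F -> isometric_chart X F.
Proof.
move=> lF; have [_ Fch Fty] := lF; split=> // a b; exact: (labelled_dist _ _ lF).
Qed.

(** The chart takes at [w] and [s] the vertex of type [s] of the chamber [f w]; [dist_face] converts
    distances between chambers into common vertices. *)
Lemma isometric_chart_exists f : (forall a b, dist (f a) (f b) (a^-1 * b)) ->
  exists X F, isometric_chart X F /\ forall w, F w @` S = f w.
Proof.
move=> fi.
have /choice[F FP] : forall ws : W * W, exists v, S ws.2 ->
    has_type v ws.2 /\ f ws.1 v.
  move=> [w s] /=; have [G [a [Gty ->]]] := typed_chamber (dist_chamberl (fi w w)).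
  by exists (G a s) => Ss; split; [exact: Gty|exists s].
pose H w s := F (w, s).
have Hty : typed H by move=> w s Ss; have [] := FP (w, s) Ss.
have Hf w : H w @` S = f w.
  have Hfw s : S s -> f w (H w s) by move=> Ss; have [] := FP (w, s) Ss.
  have [G [a [Gty fE]]] := typed_chamber (dist_chamberl (fi w w)).
  rewrite fE in Hfw *; apply: eq_imagel => s Ss; apply: (typed_sub Hty Gty) => //.
  by move=> _ [r Sr <-]; apply: Hfw.
exists [set A | exists w, A `<=` H w @` S], H; split=> //; split=> //; last first.
  by move=> a b; rewrite !Hf.
split=> // w w' s s' Ss Ss'.
have sS : S `\ s `<=` S by move=> ? [].
have face := dist_face (a := w) (b := w') Hty Hty sS.
have [|face1 face2] := face (w^-1 * w'); first by rewrite !Hf.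
split=> [E|[<- Jw]]; last first.
  by apply: face2 => // -[_]; apply.
have ss' : s = s'.
  by have := Hty w s Ss; rewrite E => ty; apply: has_type_inj ty (Hty w' s' Ss').
split=> //; apply: face1 => r Sr /not_andP[//|/contrapT ->].
by rewrite E ss'.
Qed.

Lemma isometric_chart_iso X Y F G A B :
  isometric_chart X F -> isometric_chart Y G -> X A -> X B -> Y A -> Y B ->
  exists2 h, simplicial_isomorphism X Y h & forall v, (A `|` B) v -> h v = v.
Proof.
move=> [Fch Fty Fi] [Gch Gty Gi] /Fch.2[a Aa] /Fch.2[b Bb] /Gch.2[a' Aa'] /Gch.2[b' Bb'].
pose J := [set s | S s /\ ~ A (F a s)]; pose K := [set s | S s /\ ~ B (F b s)].
have JS : J `<=` S by move=> ? [].
have KS : K `<=` S by move=> ? [].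
have FGA s : S s -> ~ J s -> F a s = G a' s.
  by move=> Ss /not_andP[//|/contrapT As]; apply: typed_mem => //; apply: Aa'.
have FGB s : S s -> ~ K s -> F b s = G b' s.
  by move=> Ss /not_andP[//|/contrapT Bs]; apply: typed_mem => //; apply: Bb'.
have [j ja] := dist_total (dist_chamberl (Fi a a)) (dist_chamberl (Gi a' a')).
have [k kb] := dist_total (dist_chamberl (Fi b b)) (dist_chamberl (Gi b' b')).
have Jj := (dist_face Fty Gty JS ja).1 FGA.
have Kk := (dist_face Fty Gty KS kb).1 FGB.
have [i Ji /dist_sym ia] := dist_residue cox dist_sym dist1 dist_mid dist_step JS Jj ja (Fi a b).
have [l Kl /dist_sym lb] := dist_residue cox dist_sym dist1 dist_mid dist_step KS Kk kb ia.
have ab := dist_inj lb (Gi a' b').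
(* Left translation by [u] carries [a] into the coset of [a'] modulo [J] and [b] into that of [b']
   modulo [K], so the induced isomorphism fixes [A] and [B] at once. *)
pose u := a' * i * a^-1.
have ua : u * a = a' * i by rewrite mulgVK.
have ub : u * b = b' * l.
  have -> : b' = a' * (a'^-1 * b') by rewrite mulVKg.
  by rewrite -ab !invgM !invgK !mulgA mulgVK.
have [h hiso hF] := charts_isomorphism Fch (chart_translate u Gch).
exists h => // v [Av|Bv].
  have [s Ss E] := Aa _ Av; have nJs : ~ J s by rewrite /J /= E => -[].
  rewrite -{1}E hF // ua -((chart_cap cox a' (a' * i) Gch JS).2 _ s Ss nJs) ?mulKg //.
  by rewrite -FGA.
have [s Ss E] := Bb _ Bv; have nKs : ~ K s by rewrite /K /= E => -[].
rewrite -{1}E hF // ub -((chart_cap cox b' (b' * l) Gch KS).2 _ s Ss nKs) ?mulKg //.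
by rewrite -FGB.
Qed.

(** * Complete apartment systems, thickness and avoidance of an infinite set *)

Hypothesis Sfin : finite_set S.
Hypothesis complete : forall Aps', apartment_system S Delta Aps' -> Aps' `<=` Aps.

(** Adjoining [X] to [Aps] preserves the apartment axioms, by [isometric_chart_iso], so maximality
    of [Aps] absorbs [X]. *)
Lemma isometric_chart_apartment X F : isometric_chart X F -> Aps X.
Proof.
move=> Fi; have [Fch Fty Fd] := Fi; apply: (complete (Aps' := Aps `|` [set X])); last by right.
have [apt1 apt2 apt3] := apt.
have ichart Y : (Aps `|` [set X]) Y -> exists G, isometric_chart Y G.
  move=> [/labelled_exists[G /labelled_isometric]|->]; first by exists G.
  by exists F.
split=> [Y [/apt1//|->]|A B DA DB|Y Y' A B /ichart[G Gi] /ichart[G' Gi']].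
- split; last exact: (chart_isomorphic cox Fch).
  split=> [|A /Fch.2[w Aw]]; last exact: chamber_sub (dist_chamberl (Fd w w)) Aw.
  split=> [|A /Fch.2[w Aw]|A B /Fch.2[w Aw] BA].
  + by apply/Fch.2; exists 1.
  + exact: sub_finite_set Aw (finite_image _ Sfin).
  + by apply/Fch.2; exists w; apply: subset_trans Aw.
- by have [Y AY YAB] := apt2 A B DA DB; exists Y => //; left.
- exact: isometric_chart_iso Gi Gi'.
Qed.

Lemma building_chamberP C : chamber Delta C <-> building_chamber C.
Proof.
split=> [[DC Cmax]|cC].
  have [X [F [w [[AX Fch F1] Cw]]]] := based_exists DC.
  have [X' [F' [lF' X'w _]]] := apt_join_labelled
    (apt_sub AX (chart_simplex w Fch)) (apt_sub AX (chart_simplex w Fch)).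
  have CE := Cmax _ (apt_sub AX (chart_simplex w Fch)) Cw.
  rewrite CE in X'w; have [_ Fch' _] := lF'; have [w' Cw'] := (Fch'.2 _).1 X'w.
  exists X', F', w'; split=> //; apply/esym/Cmax => //.
  by have [AX' _ _] := lF'; apply: apt_sub AX' (chart_simplex w' Fch').
split; first exact: chamber_sub cC (@subset_refl _ _).
move=> D DD CD; have [X [F [lF XD _]]] := apt_join_labelled DD DD.
have [AX Fch _] := lF; have [w CE] := labelled_chamber cC lF (apt_closed AX XD CD).
by rewrite CE; apply: chart_maximal Fch XD _; rewrite -CE.
Qed.

Lemma third_chamber X F a s : thick Delta -> labelled X F -> S s ->
  exists E, [/\ dist (F a @` S) E s & dist (F (a * s) @` S) E s].
Proof.
move=> th lF Ss; have [_ Fch Fty] := lF.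
have sS : [set s] `<=` S by move=> _ ->.
have aa := labelled_dist a a lF; have as_ := labelled_dist a (a * s) lF.
rewrite mulKg in as_.
have [|C1 [C2 [C3 [[c1 c2 c3] [[P1 P2 P3] [n12 n13 n23]]]]]] := th (F a @` S `\ F a s).
  exists (F a @` S), (F a s); split=> //.
  exact/building_chamberP/(dist_chamberl aa).
have [E [cE PE Ea Eas]] : exists E, [/\ chamber Delta E, F a @` S `\ F a s `<=` E,
    E <> F a @` S & E <> F (a * s) @` S].
  apply: contrapT => none.
  have two C : chamber Delta C -> F a @` S `\ F a s `<=` C ->
      C = F a @` S \/ C = F (a * s) @` S.
    move=> cC PC; apply: contrapT => /not_orP[n1 n2].
    by apply: none; exists C.
  by have [E1|E1] := two _ c1 P1; have [E2|E2] := two _ c2 P2;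
    have [E3|E3] := two _ c3 P3; rewrite E1 E2 E3 in n12 n13 n23.
have /building_chamberP cE' := cE.
have [w aE] := dist_total (dist_chamberl aa) cE'.
have [G [b [Gty EE]]] := typed_chamber cE'.
have ws : w = s.
  rewrite EE in aE PE Ea; have Jw : generated [set s] w.
    apply/(dist_face Fty Gty sS aE) => r Sr rs.
    apply: typed_mem => //; apply: PE.
    by split; [exists r|move=> /(chart_type Fch Sr Ss)].
  have [w1|//] := generated_set1 cox Ss Jw.
  by rewrite w1 in aE; case: Ea; rewrite (dist1 aE).
rewrite ws in aE; exists E; split=> //.
have [|] := dist_step Ss as_ aE => //.
by rewrite (gen_sqr cox) // => /dist1 E'; case: Eas.
Qed.

Local Notation N := (crossing cox).

(** Otherwise, for each simplex of [kappa], all walls of a minimal representative [d] of its coset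
    separate 1 from [b], whence [d] is no longer than [b]. Finitely many chambers satisfy this
    bound, and each has finitely many faces. *)
Lemma separating_wall X F b kappa : chart S X F -> kappa `<=` X -> infinite_set kappa ->
  exists A c J t, [/\ kappa A, J `<=` S, A = F c @` (S `\` J), ~~ N b t &
    forall j, generated J j -> N (c * j) t].
Proof.
move=> Fch kX kinf; apply: contrapT => none; apply: kinf.
apply: (@sub_finite_set _ _ (\bigcup_(c in [set c | (len cox c <= len cox b)%N])
    [set A | A `<=` F c @` S])); last first.
  apply: bigcup_finite => [|c _]; first exact: finite_len.
  apply: (@sub_finite_set _ _ [set F c @` J | J in [set J | J `<=` S]]).
    move=> A Ac; exists [set s | S s /\ A (F c s)]; first by move=> ? [].
    apply/seteqP; split=> [_ [s [_ As] <-] //|v Av].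
    by have [s Ss E] := Ac _ Av; exists s => //; split=> //; rewrite E.
  exact/finite_image/finite_subsets.
move=> A kA; have [c Ac] := (Fch.2 _).1 (kX _ kA).
pose J := [set s | S s /\ ~ A (F c s)]; have JS : J `<=` S by move=> ? [].
have [d Jd dP] := min_coset_rep cox c JS.
have cd := (chart_cap cox c d Fch JS).2 Jd.
have AE : A = F d @` (S `\` J).
  apply/seteqP; split=> [v Av|_ [s [Ss nJs] <-]].
    have [s Ss E] := Ac _ Av; have nJ : ~ J s by rewrite /J /= E => -[].
    by exists s => //; rewrite -cd.
  by rewrite -cd //; move: nJs => /not_andP[//|/contrapT].
exists d; last by rewrite AE => _ [s [Ss _] <-]; exists s.
apply: cross_sub_len => t Ndt; apply/negPn/negP => Nbt; apply: none.
by exists A, d, J, t; split=> // j Jj; apply: dP.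
Qed.

Lemma apartment_avoiding kappa A B : thick Delta -> infinite_set kappa ->
  Delta A -> Delta B -> exists2 X, Aps X /\ ~ kappa `<=` X & X A /\ X B.
Proof.
move=> th kinf DA DB; have [X [F1 [lF1 XA XB]]] := apt_join_labelled DA DB.
have [AX F1ch F1ty] := lF1.
have [kX|nkX] := pselect (kappa `<=` X); last by exists X.
have [a0 Aa0] := (F1ch.2 _).1 XA.
(* Recentring puts [A] in the chamber 1, so that the walls to consider are those separating 1 from
   [b]. *)
pose F w := F1 (a0 * w).
have Fch : chart S X F := chart_translate a0 F1ch.
have lF : labelled X F by split=> // w s; apply: F1ty.
have [_ _ Fty] := lF; have Fd a b := labelled_dist a b lF.
have A1 : A `<=` F 1 @` S by rewrite /F mulg1.
have [b Bb] := (Fch.2 _).1 XB.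
have [K [c [J [t [kK JS KE Nbt NcJ]]]]] := separating_wall b Fch kX kinf.
(* The [s]-panel of the chamber [a] lies in the wall of [t], with [a] on the side of 1 and [a * s]
   beyond it. *)
have := NcJ 1 (@generated1 _ J); rewrite mulg1 => /cross_conj_gen[a [s [Ss st Nat]]].
have Ns u : N u t = N (a^-1 * u) s.
  by rewrite -{1}[u](mulVKg a) crossM (negbTE Nat) st.
have [E [aE asE]] := third_chamber a th lF Ss.
(* The graph of the chart on the root bounded by the wall of [t] that contains 1 and [b]. *)
pose R : set (W * set V) := [set p | ~~ N p.1 t /\ p.2 = F p.1 @` S].
have Ri : isometric dist R by move=> x C y D [/= _ ->] [/= _ ->].
have [||f [fd fR]] := isometric_extend cox dist_inj dist_sym dist1 dist_mid dist_step
    (P := R `|` [set (a * s, E)]).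
- by exists (a * s, E); right.
- apply: (isometric_extend_by dist_sym Ri); first exact: dist_refl (dist_chamberr aE).
  move=> y D [/= Nyt ->]; rewrite invgM (gen_inv cox Ss) -mulgA.
  by apply: (dist_increasing dist_inj dist_sym dist1 dist_mid dist_step Ss aE) => //; rewrite -Ns.
have [X' [G [Gi Gf]]] := isometric_chart_exists fd; have [Gch Gty Gd] := Gi.
have fF y : ~~ N y t -> G y @` S = F y @` S.
  by move=> Nyt; rewrite Gf; apply: fR; left.
have fE : G (a * s) @` S = E by rewrite Gf; apply: fR; right.
exists X'; last first.
  split; apply/Gch.2; first by exists 1; rewrite fF // cross1.
  by exists b; rewrite fF.
split; first exact: isometric_chart_apartment Gi.
move=> /(_ K kK) /Gch.2[c' Kc'].
have FG r : S r -> ~ J r -> F c r = G c' r.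
  by move=> Sr nJr; apply: typed_mem => //; apply: Kc'; rewrite KE; exists r.
have residue := dist_residue cox dist_sym dist1 dist_mid dist_step JS.
have [j jc] := dist_total (dist_chamberl (Fd c c)) (dist_chamberl (Gd c' c')).
have Jj := (dist_face Fty Gty JS jc).1 FG.
(* The chamber [a] is the same in both apartments; comparing distances to it shows that [c'] lies in
   the coset of [c] modulo [J]. *)
have [i Ji ic] := residue _ _ _ _ _ Jj jc (Fd c a).
have ci : c^-1 * c' = i^-1.
  have := Gd c' a; rewrite (fF a Nat) => /(dist_inj ic) ca.
  have icE : i * c^-1 = c'^-1 by apply: (mulIg a); rewrite -mulgA.
  by rewrite -[c']invgK -icE invgM invgK mulKg.
have Jc : generated J (c^-1 * c') by rewrite ci; apply: generatedV.
have Fcc' := (chart_cap cox c c' Fch JS).2 Jc.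
have [k kc] := dist_total (dist_chamberl (Fd c' c')) (dist_chamberl (Gd c' c')).
have Jk : generated J k.
  by apply/(dist_face Fty Gty JS kc) => r Sr nJr; rewrite -Fcc' // FG.
have Nc's : N (a^-1 * c') s.
  by rewrite -Ns -[c'](mulVKg c); apply: NcJ.
(* In [X] the chamber [a * s] is on the side of [c']; the chamber [E], adjacent to it across the
   wall, is at the same distance from [c'] as [a]. *)
have Ec' : dist E (F c' @` S) (a^-1 * c').
  rewrite -[a^-1 * c'](gen_mulK cox _ Ss).
  apply: (dist_increasing dist_inj dist_sym dist1 dist_mid dist_step Ss asE).
    by have := Fd (a * s) c'; rewrite invgM (gen_inv cox Ss) -mulgA.
  by rewrite cross_genM // negbK.
(* E lies at distance a^-1 c' from F c' and s a^-1 c' from G c'; both contain K,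
   so the reflection of c' in the wall would lie in c W_J. *)
have [l Jl lE] := residue _ _ _ _ _ Jk kc (dist_sym Ec').
have := Gd c' (a * s); rewrite fE => /(dist_inj lE) lasE.
have c'l : c' * l = a * (s * (a^-1 * c')).
  apply: (mulIg (a^-1 * c')^-1); rewrite -[LHS]mulgA lasE mulVKg.
  by rewrite (mulgA a) mulgK.
have : N (c' * l) t.
  by rewrite -[c'](mulVKg c) -mulgA; apply: NcJ; apply: generatedM.
by rewrite c'l Ns mulKg cross_genM // Nc's.
Qed.

End Labelling.

Theorem proposition5p1 (W : groupType) (S : set W) (V : Type)
    (Delta : set (set V)) (Aps : set (set (set V)))
    (Sigma : set (set V)) (kappa : set (set V)) :
  coxeter_system S -> finite_set S ->
  building S Delta -> thick Delta ->
  complete_apartment_system S Delta Aps ->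
  Aps Sigma ->
  kappa `<=` Sigma -> infinite_set kappa ->
  let Astar := [set X | Aps X /\ ~ (kappa `<=` X)] in
  let A' := Astar `|` [set Sigma] in
  [/\ apartment_system S Delta Astar,
      apartment_system S Delta A',
      exists! X, A' X /\ kappa `<=` X
    & kappa <> Sigma -> convex_subcomplex Sigma kappa ->
        kappa <> \bigcap_(X in [set X | A' X /\ kappa `<=` X]) X].
Proof.
move=> cox Sfin _ th [apt complete] ASigma kSigma kinf Astar A'.
have [apt1 apt2 apt3] := apt.
(* Without vertices the empty simplex would be the only one, and [kappa] would be finite. *)
have [v0] : exists v : V, True.
  apply: contrapT => nV; apply: kinf; apply: (sub_finite_set _ (finite_set1 set0)).
  by move=> A _; apply/seteqP; split=> // v; case: nV; exists v.
have [[Sigma_cx _] Sigma_iso] := apt1 _ ASigma.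
have [F Fch] := isomorphic_chart cox v0 Sigma_cx Sigma_iso.
have Astar2 A B : Delta A -> Delta B -> exists2 X, Astar X & X A /\ X B.
  exact: (apartment_avoiding cox apt ASigma Fch Sfin complete th kinf).
have A'Aps : A' `<=` Aps by move=> X [[]|->].
have A'_kappa X : A' X -> kappa `<=` X -> X = Sigma by move=> [[]|].
split.
- split=> [X [/apt1//]|//|X Y A B [AX _] [AY _]]; exact: apt3.
- split=> [X /A'Aps/apt1//|A B DA DB|X Y A B /A'Aps AX /A'Aps AY]; last exact: apt3.
  by have [X AX XAB] := Astar2 A B DA DB; exists X => //; left.
- exists Sigma; split; first by split=> //; right.
  by move=> X [A'X kX]; rewrite (A'_kappa X).
(* The intersection runs over [Sigma] alone, so equality would force [kappa] to be [Sigma]. *)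
- move=> kS _ E; apply: kS; apply/seteqP; split=> // A SA; rewrite E => X [A'X kX].
  by rewrite (A'_kappa X).
Qed.
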